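(* Let $(\mathscr{F},\Phi):\mathsf{B}\to\mathsf{B}'$ be a homomorphism of bicategories. Then there is a homomorphism of bicategories $\mathsf{W}(\mathscr{F},\Phi):\mathsf{W}(\mathsf{B})\to\mathsf{W}(\mathsf{B}')$ between the associated bicategories of wide right Morita contexts, namely the one induced by $(\mathscr{F},\Phi)$ with the function on $0$-cells, the functors on hom-categories, and the constraints described in the context.
   Context: Conventions for bicategories. A bicategory $\mathsf{B}$ has a class of $0$-cells; for each pair of $0$-cells $A,B$ a category ${}_A\mathsf{B}_B$, whose objects are the $1$-cells from $B$ to $A$ and whose morphisms are the $2$-cells (composition in this category is written $\circ$); multiplication functors ${}_A\mathsf{B}_B\times{}_B\mathsf{B}_C\to{}_A\mathsf{B}_C$, $(f,g)\mapsto fg$ on $1$-cells and $(\alpha,\beta)\mapsto\alpha\beta$ on $2$-cells; identity $1$-cells $\mathbb{I}_A\in{}_A\mathsf{B}_A$; and natural isomorphisms $\mathfrak{a}_{f,g,h}:(fg)h\to f(gh)$, $\mathfrak{r}_f:f\mathbb{I}_B\to f$, $\mathfrak{l}_f:\mathbb{I}_Af\to f$ satisfying the usual pentagon and triangle axioms. $1_f$ denotes the identity $2$-cell of $f$. For $\mathsf{B}'$ the structure is denoted with primes. Homomorphism. A homomorphism $(\mathscr{F},\Phi):\mathsf{B}\to\mathsf{B}'$ consists of a function $\mathscr{F}$ on $0$-cells, functors $\mathscr{F}_{A,B}:{}_A\mathsf{B}_B\to{}_{\mathscr{F}(A)}\mathsf{B}'_{\mathscr{F}(B)}$ (written $\mathscr{F}$),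 and isomorphisms $\Phi^1_{f,g}:\mathscr{F}(f)\mathscr{F}(g)\to\mathscr{F}(fg)$, natural in $f,g$, and $\Phi^0_A:\mathbb{I}'_{\mathscr{F}(A)}\to\mathscr{F}(\mathbb{I}_A)$, such that $\mathscr{F}(\mathfrak{a})\circ\Phi^1_{fg,h}\circ(\Phi^1_{f,g}1)=\Phi^1_{f,gh}\circ(1\,\Phi^1_{g,h})\circ\mathfrak{a}'$, $\ \Phi^1_{f,\mathbb{I}_B}\circ(1\,\Phi^0_B)=\mathscr{F}(\mathfrak{r}_f^{-1})\circ\mathfrak{r}'_{\mathscr{F}(f)}$ and $\Phi^1_{\mathbb{I}_A,f}\circ(\Phi^0_A\,1)=\mathscr{F}(\mathfrak{l}_f^{-1})\circ\mathfrak{l}'_{\mathscr{F}(f)}$. The bicategory $\mathsf{W}(\mathsf{B})$. Its $0$-cells are those of $\mathsf{B}$. Its $1$-cells from $B$ to $A$ are the wide right Morita contexts $\Gamma=(f,g,\eta,\rho)$: $f\in{}_A\mathsf{B}_B$, $g\in{}_B\mathsf{B}_A$, $\eta:fg\to\mathbb{I}_A$, $\rho:gf\to\mathbb{I}_B$ with $$\mathfrak{r}_g\circ(1_g\,\eta)\circ\mathfrak{a}_{g,f,g}=\mathfrak{l}_g\circ(\rho\,1_g),\qquad \mathfrak{l}_f\circ(\eta\,1_f)=\mathfrak{r}_f\circ(1_f\,\rho)\circ\mathfrak{a}_{f,g,f}.$$ Its $2$-cells $(f,g,\eta,\rho)\to(f',g',\eta',\rho')$ are pairs $(\alpha:f\to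 f',\ \beta:g\to g')$ with $\eta'\circ(\alpha\beta)=\eta$ and $\rho'\circ(\beta\alpha)=\rho$, composed componentwise. Identity $1$-cells are $\overline{\mathbb{I}}_A=(\mathbb{I}_A,\mathbb{I}_A,\mathfrak{r}_{\mathbb{I}_A},\mathfrak{l}_{\mathbb{I}_A})$. For $\Gamma=(f,g,\eta,\rho)$ from $B$ to $A$ and $\Lambda=(p,q,\gamma,\mu)$ from $C$ to $B$, $\Gamma\Lambda=(fp,qg,\eta\ast\gamma,\mu\ast\rho)$ with $\eta\ast\gamma=\eta\circ(1_f\,\mathfrak{l}_g)\circ(1_f(\gamma\,1_g))\circ(1_f\,\mathfrak{a}^{-1}_{p,q,g})\circ\mathfrak{a}_{f,p,qg}$ and $\mu\ast\rho=\mu\circ(1_q\,\mathfrak{l}_p)\circ(1_q(\rho\,1_p))\circ(1_q\,\mathfrak{a}^{-1}_{g,f,p})\circ\mathfrak{a}_{q,g,fp}$; on $2$-cells $(\alpha,\beta)(\varsigma,\tau)=(\alpha\varsigma,\tau\beta)$. The associativity constraint at $\Gamma$, $\Lambda$, $\Omega=(u,v,\theta,\sigma)$ is $(\mathfrak{a}_{f,p,u},\mathfrak{a}^{-1}_{v,q,g})$; the right and left identity constraints at $\Gamma$ are $(\mathfrak{r}_f,\mathfrak{l}_g)$ and $(\mathfrak{l}_f,\mathfrak{r}_g)$. The induced homomorphism $\mathsf{W}(\mathscr{F},\Phi)$. On $0$-cells it is $\mathscr{F}$. On $1$-cells it sends $(f,g,\eta,\rho)$ (from $B$ to $A$) to $(\mathscr{F}(f),\mathscr{F}(g),\eta',\rho')$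 with $\eta'=(\Phi^0_A)^{-1}\circ\mathscr{F}(\eta)\circ\Phi^1_{f,g}$ and $\rho'=(\Phi^0_B)^{-1}\circ\mathscr{F}(\rho)\circ\Phi^1_{g,f}$. On $2$-cells it sends $(\alpha,\beta)$ to $(\mathscr{F}(\alpha),\mathscr{F}(\beta))$. Its constraints are $(\Phi^1_{f,p},\Phi^1_{q,g})$, from the product of the images of $\Gamma=(f,g,\eta,\rho)$ and $\Lambda=(p,q,\gamma,\mu)$ to the image of $\Gamma\Lambda$, and $(\Phi^0_A,\Phi^0_A)$, from $\overline{\mathbb{I}'}_{\mathscr{F}(A)}$ to the image of $\overline{\mathbb{I}}_A$. *)

(* Defs.v *)
From Stdlib Require Import ssreflect ProofIrrelevance.

Set Implicit Arguments.
Unset Strict Implicit.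
Unset Printing Implicit Defensive.

Declare Scope bicat_scope.
Delimit Scope bicat_scope with bicat.
Local Open Scope bicat_scope.

Reserved Notation "β ∘ α" (at level 40, left associativity).
Reserved Notation "f ⋅ g" (at level 37, left associativity).
Reserved Notation "α ⊙ β" (at level 37, left associativity).

Record category := Category {
  obj :> Type;
  mor : obj -> obj -> Type;
  idm : forall x, mor x x;
  comp : forall x y z, mor y z -> mor x y -> mor x z;
  comp1m : forall x y (α : mor x y), comp (idm y) α = α;
  compm1 : forall x y (α : mor x y), comp α (idm x) = α;
  compA : forall x y z w (γ : mor z w) (β : mor y z) (α : mor x y),
    comp (comp γ β) α = comp γ (comp β α) }.

Arguments mor {c} x y.
Arguments idm {c} x.
Arguments comp {c x y z} β α : rename.
Arguments comp1m {c x y} α.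
Arguments compm1 {c x y} α.
Arguments compA {c x y z w} γ β α.

Notation "β ∘ α" := (comp β α) : bicat_scope.

Record iso (C : category) (x y : C) := Iso {
  fwd :> mor x y;
  inv : mor y x;
  fwdK : inv ∘ fwd = idm x;
  invK : fwd ∘ inv = idm y }.

Arguments inv {C x y} i : rename.
Arguments fwdK {C x y} i : rename.
Arguments invK {C x y} i : rename.

Definition iso_inv (C : category) (x y : C) (i : iso x y) : iso y x :=
  Iso (invK i) (fwdK i).

Record functor (C D : category) := Functor {
  fobj :> C -> D;
  fmor : forall x y, mor x y -> mor (fobj x) (fobj y);
  fmor1 : forall x, fmor (idm x) = idm (fobj x);
  fmorM : forall x y z (β : mor y z) (α : mor x y),
    fmor (β ∘ α) = fmor β ∘ fmor α }.

Arguments fmor {C D} f {x y} α : rename.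
Arguments fmor1 {C D} f x : rename.
Arguments fmorM {C D} f {x y z} β α : rename.

Definition prod_category (C D : category) : category.
Proof.
refine (@Category (C * D) (fun p q => mor (fst p) (fst q) * mor (snd p) (snd q))%type
  (fun p => (idm (fst p), idm (snd p)))
  (fun p q r β α => (fst β ∘ fst α, snd β ∘ snd α)) _ _ _).
- by move=> x y [α α'] /=; rewrite !comp1m.
- by move=> x y [α α'] /=; rewrite !compm1.
- by move=> x y z w γ β α /=; rewrite !compA.
Defined.

(* The objects of [hom A B] are the 1-cells from B to A, not from A to B, so that
   [mult] composes in the order in which it is written. *)
Record bicat_data := BicatData {
  cell0 :> Type;
  hom : cell0 -> cell0 -> category;
  mult : forall A B C, functor (prod_category (hom A B) (hom B C)) (hom A C);
  one : forall A, hom A A;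
  assoc : forall A B C D (f : hom A B) (g : hom B C) (h : hom C D),
    iso (mult A C D (mult A B C (f, g), h)) (mult A B D (f, mult B C D (g, h)));
  runit : forall A B (f : hom A B), iso (mult A B B (f, one B)) f;
  lunit : forall A B (f : hom A B), iso (mult A A B (one A, f)) f }.

Arguments hom {b} A B : rename.
Arguments mult {b} A B C : rename.
Arguments one {b} A : rename.
Arguments assoc {b A B C D} f g h : rename.
Arguments runit {b A B} f : rename.
Arguments lunit {b A B} f : rename.

Definition mul1 {𝓑 : bicat_data} {A B C : 𝓑} (f : hom A B) (g : hom B C) : hom A C :=
  mult A B C (f, g).

Notation "f ⋅ g" := (mul1 f g) : bicat_scope.

Definition mul2 {𝓑 : bicat_data} {A B C : 𝓑} {f f' : hom A B} {g g' : hom B C}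
    (α : mor f f') (β : mor g g') : mor (f ⋅ g) (f' ⋅ g') :=
  @fmor _ _ (mult A B C) (f, g) (f', g') (α, β).

Notation "α ⊙ β" := (mul2 α β) : bicat_scope.

Record is_bicategory (𝓑 : bicat_data) : Prop := IsBicategory {
  assoc_nat_ax : forall (A B C D : 𝓑) (f f' : hom A B) (g g' : hom B C) (h h' : hom C D)
      (α : mor f f') (β : mor g g') (γ : mor h h'),
    assoc f' g' h' ∘ ((α ⊙ β) ⊙ γ) = (α ⊙ (β ⊙ γ)) ∘ assoc f g h;
  runit_nat_ax : forall (A B : 𝓑) (f f' : hom A B) (α : mor f f'),
    runit f' ∘ (α ⊙ idm (one B)) = α ∘ runit f;
  lunit_nat_ax : forall (A B : 𝓑) (f f' : hom A B) (α : mor f f'),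
    lunit f' ∘ (idm (one A) ⊙ α) = α ∘ lunit f;
  pentagon_ax : forall (A B C D E : 𝓑) (f : hom A B) (g : hom B C) (h : hom C D) (k : hom D E),
    (idm f ⊙ assoc g h k) ∘ assoc f (g ⋅ h) k ∘ (assoc f g h ⊙ idm k) =
    assoc f g (h ⋅ k) ∘ assoc (f ⋅ g) h k;
  triangle_ax : forall (A B C : 𝓑) (f : hom A B) (g : hom B C),
    (idm f ⊙ lunit g) ∘ assoc f (one B) g = runit f ⊙ idm g }.

Record bicategory := Bicategory {
  bicat :> bicat_data;
  bicatP : is_bicategory bicat }.

Record hom_data (𝓑 𝓑' : bicat_data) := HomData {
  hob :> 𝓑 -> 𝓑';
  hfun : forall A B : 𝓑, functor (hom A B) (hom (hob A) (hob B));
  hΦ1 : forall (A B C : 𝓑) (f : hom A B) (g : hom B C),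
    iso (hfun A B f ⋅ hfun B C g) (hfun A C (f ⋅ g));
  hΦ0 : forall A : 𝓑, iso (one (hob A)) (hfun A A (one A)) }.

Arguments hfun {𝓑 𝓑'} F {A B} : rename.
Arguments hΦ1 {𝓑 𝓑'} F {A B C} f g : rename.
Arguments hΦ0 {𝓑 𝓑'} F A : rename.

Record is_homomorphism (𝓑 𝓑' : bicat_data) (F : hom_data 𝓑 𝓑') : Prop := IsHomomorphism {
  hΦ1_nat : forall (A B C : 𝓑) (f f' : hom A B) (g g' : hom B C)
      (α : mor f f') (β : mor g g'),
    hΦ1 F f' g' ∘ (fmor (hfun F) α ⊙ fmor (hfun F) β) =
    fmor (hfun F) (α ⊙ β) ∘ hΦ1 F f g;
  hΦ1_assoc : forall (A B C D : 𝓑) (f : hom A B) (g : hom B C) (h : hom C D),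
    fmor (hfun F) (assoc f g h) ∘ hΦ1 F (f ⋅ g) h ∘ (hΦ1 F f g ⊙ idm (hfun F h)) =
    hΦ1 F f (g ⋅ h) ∘ (idm (hfun F f) ⊙ hΦ1 F g h)
      ∘ assoc (hfun F f) (hfun F g) (hfun F h);
  hΦ0_runit : forall (A B : 𝓑) (f : hom A B),
    hΦ1 F f (one B) ∘ (idm (hfun F f) ⊙ hΦ0 F B) =
    fmor (hfun F) (inv (runit f)) ∘ runit (hfun F f);
  hΦ0_lunit : forall (A B : 𝓑) (f : hom A B),
    hΦ1 F (one A) f ∘ (hΦ0 F A ⊙ idm (hfun F f)) =
    fmor (hfun F) (inv (lunit f)) ∘ lunit (hfun F f) }.

Record homomorphism (𝓑 𝓑' : bicategory) := Homomorphism {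
  homdata :> hom_data 𝓑 𝓑';
  homP : is_homomorphism homdata }.

Record wide_data (𝓑 : bicat_data) (A B : 𝓑) := WideData {
  wf : hom A B;
  wg : hom B A;
  wη : mor (wf ⋅ wg) (one A);
  wρ : mor (wg ⋅ wf) (one B) }.

Definition is_wide_context (𝓑 : bicat_data) (A B : 𝓑) (Γ : wide_data A B) : Prop :=
  let f := wf Γ in let g := wg Γ in let η := wη Γ in let ρ := wρ Γ in
  runit g ∘ (idm g ⊙ η) ∘ assoc g f g = lunit g ∘ (ρ ⊙ idm g) /\
  lunit f ∘ (η ⊙ idm f) = runit f ∘ (idm f ⊙ ρ) ∘ assoc f g f.

Record wide_context (𝓑 : bicat_data) (A B : 𝓑) := WideContext {
  wdata :> wide_data A B;
  wP : is_wide_context wdata }.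

Definition is_wide_mor (𝓑 : bicat_data) (A B : 𝓑) (Γ Γ' : wide_data A B)
    (α : mor (wf Γ) (wf Γ')) (β : mor (wg Γ) (wg Γ')) : Prop :=
  wη Γ' ∘ (α ⊙ β) = wη Γ /\ wρ Γ' ∘ (β ⊙ α) = wρ Γ.

Record wide_mor (𝓑 : bicat_data) (A B : 𝓑) (Γ Γ' : wide_data A B) := WideMor {
  wα : mor (wf Γ) (wf Γ');
  wβ : mor (wg Γ) (wg Γ');
  wmP : is_wide_mor wα wβ }.

Lemma wide_mor_eq (𝓑 : bicat_data) (A B : 𝓑) (Γ Γ' : wide_data A B) (m n : wide_mor Γ Γ') :
  wα m = wα n -> wβ m = wβ n -> m = n.
Proof.
case: m n => α β p [α' β' q] /= e e'; subst α' β'.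
by rewrite (proof_irrelevance _ p q).
Qed.

Lemma mul2_1 (𝓑 : bicat_data) (A B C : 𝓑) (f : hom A B) (g : hom B C) :
  idm f ⊙ idm g = idm (f ⋅ g).
Proof. exact: (@fmor1 _ _ (mult A B C) (f, g)). Qed.

Lemma mul2M (𝓑 : bicat_data) (A B C : 𝓑) (f f' f'' : hom A B) (g g' g'' : hom B C)
    (α' : mor f' f'') (α : mor f f') (β' : mor g' g'') (β : mor g g') :
  (α' ⊙ β') ∘ (α ⊙ β) = (α' ∘ α) ⊙ (β' ∘ β).
Proof.
by symmetry; exact: (@fmorM _ _ (mult A B C) (f, g) (f', g') (f'', g'') (α', β') (α, β)).
Qed.

Lemma wide_idP (𝓑 : bicat_data) (A B : 𝓑) (Γ : wide_data A B) :
  is_wide_mor (idm (wf Γ)) (idm (wg Γ)).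
Proof. by split; rewrite mul2_1 compm1. Qed.

Lemma wide_compP (𝓑 : bicat_data) (A B : 𝓑) (Γ Γ' Γ'' : wide_data A B)
    (n : wide_mor Γ' Γ'') (m : wide_mor Γ Γ') :
  is_wide_mor (wα n ∘ wα m) (wβ n ∘ wβ m).
Proof.
case: n m => α' β' [p' q'] [α β [p q]].
by split; rewrite -mul2M -compA /= ?p' ?q'.
Qed.

Definition wide_category (𝓑 : bicat_data) (A B : 𝓑) : category.
Proof.
refine (@Category (wide_context A B) (fun Γ Γ' => wide_mor Γ Γ')
  (fun Γ => WideMor (wide_idP Γ)) (fun _ _ _ n m => WideMor (wide_compP n m)) _ _ _).
- by move=> *; apply: wide_mor_eq; rewrite /= comp1m.
- by move=> *; apply: wide_mor_eq; rewrite /= compm1.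
- by move=> *; apply: wide_mor_eq; rewrite /= compA.
Defined.

Lemma wide_mor_inv (𝓑 : bicat_data) (A B : 𝓑) (Γ Γ' : wide_data A B)
    (i : iso (wf Γ) (wf Γ')) (j : iso (wg Γ) (wg Γ')) :
  is_wide_mor i j -> is_wide_mor (inv i) (inv j).
Proof.
case=> e e'; split; [rewrite -e | rewrite -e']; rewrite compA mul2M !invK mul2_1 compm1 //.
Qed.

(* A pair of isomorphisms whose forward components form a 2-cell of W(B) is an
   isomorphism there: the inverse components then form a 2-cell as well. *)
Definition wide_iso (𝓑 : bicat_data) (A B : 𝓑) (Γ Γ' : wide_context A B)
    (i : iso (wf Γ) (wf Γ')) (j : iso (wg Γ) (wg Γ')) (p : is_wide_mor i j) :
  @iso (wide_category A B) Γ Γ'.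
Proof.
refine (@Iso (wide_category A B) Γ Γ' (WideMor p) (WideMor (wide_mor_inv p)) _ _).
- by apply: wide_mor_eq; rewrite /= fwdK.
- by apply: wide_mor_eq; rewrite /= invK.
Defined.

Definition star (𝓑 : bicat_data) (A B C : 𝓑) (f : hom A B) (g : hom B A)
    (p : hom B C) (q : hom C B) (η : mor (f ⋅ g) (one A)) (γ : mor (p ⋅ q) (one B)) :
  mor ((f ⋅ p) ⋅ (q ⋅ g)) (one A) :=
  η ∘ (idm f ⊙ lunit g) ∘ (idm f ⊙ (γ ⊙ idm g)) ∘ (idm f ⊙ inv (assoc p q g))
    ∘ assoc f p (q ⋅ g).

Definition wide_one_data (𝓑 : bicat_data) (A : 𝓑) : wide_data A A :=
  @WideData 𝓑 A A (one A) (one A) (runit (one A)) (lunit (one A)).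

Definition wide_mul_data (𝓑 : bicat_data) (A B C : 𝓑) (Γ : wide_data A B)
    (Λ : wide_data B C) : wide_data A C :=
  @WideData 𝓑 A C (wf Γ ⋅ wf Λ) (wg Λ ⋅ wg Γ)
    (star (wη Γ) (wη Λ)) (star (wρ Λ) (wρ Γ)).

Lemma comp_reassoc (C : category) (x y z : C) (β : mor y z) (α : mor x y) (γ : mor x z) :
  β ∘ α = γ -> forall w (δ : mor w x), β ∘ (α ∘ δ) = γ ∘ δ.
Proof. by move=> <- *; rewrite compA. Qed.

Lemma iso_epi (C : category) (x y z : C) (i : iso x y) (α β : mor y z) :
  α ∘ i = β ∘ i -> α = β.
Proof.
move=> e; rewrite -(compm1 α) -(compm1 β) -(invK i) -!compA.
by rewrite e.
Qed.

Lemma iso_mono (C : category) (x y z : C) (i : iso y z) (α β : mor x y) :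
  i ∘ α = i ∘ β -> α = β.
Proof. by move=> e; rewrite -(comp1m α) -(comp1m β) -(fwdK i) !compA e. Qed.

Lemma iso_moveL (C : category) (x y z : C) (i : iso x y) (α : mor y z) (β : mor x z) :
  α ∘ i = β -> α = β ∘ inv i.
Proof. by move=> <-; rewrite compA invK compm1. Qed.

Lemma mul2_whisk_l (𝓑 : bicat_data) (A B C : 𝓑) (f : hom A B) (g g' g'' : hom B C)
    (β' : mor g' g'') (β : mor g g') :
  idm f ⊙ (β' ∘ β) = (idm f ⊙ β') ∘ (idm f ⊙ β).
Proof. by rewrite mul2M comp1m. Qed.

Lemma mul2_whisk_r (𝓑 : bicat_data) (A B C : 𝓑) (f f' f'' : hom A B) (g : hom B C)
    (α' : mor f' f'') (α : mor f f') :
  (α' ∘ α) ⊙ idm g = (α' ⊙ idm g) ∘ (α ⊙ idm g).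
Proof. by rewrite mul2M comp1m. Qed.

Lemma mul2_split (𝓑 : bicat_data) (A B C : 𝓑) (f f' : hom A B) (g g' : hom B C)
    (α : mor f f') (β : mor g g') :
  α ⊙ β = (α ⊙ idm g') ∘ (idm f ⊙ β).
Proof. by rewrite mul2M comp1m compm1. Qed.

Lemma mul2_split' (𝓑 : bicat_data) (A B C : 𝓑) (f f' : hom A B) (g g' : hom B C)
    (α : mor f f') (β : mor g g') :
  α ⊙ β = (idm f' ⊙ β) ∘ (α ⊙ idm g).
Proof. by rewrite mul2M comp1m compm1. Qed.

Definition mul2_iso (𝓑 : bicat_data) (A B C : 𝓑) (f f' : hom A B) (g g' : hom B C)
    (i : iso f f') (j : iso g g') : iso (f ⋅ g) (f' ⋅ g').
Proof.
by apply: (@Iso _ _ _ (i ⊙ j) (inv i ⊙ inv j)); rewrite mul2M ?fwdK ?invK mul2_1.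
Defined.

Definition iso_id (C : category) (x : C) : iso x x := Iso (comp1m (idm x)) (comp1m (idm x)).

Section Coherence.

Context {𝓑 : bicategory}.
Implicit Types A B C D : 𝓑.

Lemma assoc_nat A B C D (f f' : hom A B) (g g' : hom B C) (h h' : hom C D)
    (α : mor f f') (β : mor g g') (γ : mor h h') :
  assoc f' g' h' ∘ ((α ⊙ β) ⊙ γ) = (α ⊙ (β ⊙ γ)) ∘ assoc f g h.
Proof. exact: (assoc_nat_ax (bicatP 𝓑)). Qed.

Lemma assoc_nat_l A B C D (f f' : hom A B) (g : hom B C) (h : hom C D) (α : mor f f') :
  assoc f' g h ∘ ((α ⊙ idm g) ⊙ idm h) = (α ⊙ idm (g ⋅ h)) ∘ assoc f g h.
Proof. by rewrite assoc_nat mul2_1. Qed.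

Lemma assoc_nat_r A B C D (f : hom A B) (g : hom B C) (h h' : hom C D) (γ : mor h h') :
  assoc f g h' ∘ (idm (f ⋅ g) ⊙ γ) = (idm f ⊙ (idm g ⊙ γ)) ∘ assoc f g h.
Proof. by rewrite -mul2_1 assoc_nat. Qed.

Lemma runit_nat A B (f f' : hom A B) (α : mor f f') :
  runit f' ∘ (α ⊙ idm (one B)) = α ∘ runit f.
Proof. exact: (runit_nat_ax (bicatP 𝓑)). Qed.

Lemma lunit_nat A B (f f' : hom A B) (α : mor f f') :
  lunit f' ∘ (idm (one A) ⊙ α) = α ∘ lunit f.
Proof. exact: (lunit_nat_ax (bicatP 𝓑)). Qed.

Lemma pentagon A B C D E (f : hom A B) (g : hom B C) (h : hom C D) (k : hom D E) :
  (idm f ⊙ assoc g h k) ∘ (assoc f (g ⋅ h) k ∘ (assoc f g h ⊙ idm k)) =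
  assoc f g (h ⋅ k) ∘ assoc (f ⋅ g) h k.
Proof. by rewrite -compA; exact: (pentagon_ax (bicatP 𝓑)). Qed.

Lemma triangle A B C (f : hom A B) (g : hom B C) :
  (idm f ⊙ lunit g) ∘ assoc f (one B) g = runit f ⊙ idm g.
Proof. exact: (triangle_ax (bicatP 𝓑)). Qed.

Lemma mul1_inj A B (f f' : hom A B) (α β : mor f f') :
  idm (one A) ⊙ α = idm (one A) ⊙ β -> α = β.
Proof. by move=> e; apply: (@iso_epi _ _ _ _ (lunit f)); rewrite -!lunit_nat e. Qed.

Lemma mulr1_inj A B (f f' : hom A B) (α β : mor f f') :
  α ⊙ idm (one B) = β ⊙ idm (one B) -> α = β.
Proof. by move=> e; apply: (@iso_epi _ _ _ _ (runit f)); rewrite -!runit_nat e. Qed.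

Lemma lunit_mul A B C (f : hom A B) (g : hom B C) :
  lunit (f ⋅ g) ∘ assoc (one A) f g = lunit f ⊙ idm g.
Proof.
apply: mul1_inj.
apply: (@iso_epi _ _ _ _ (assoc (one A) (one A ⋅ f) g)).
apply: (@iso_epi _ _ _ _ (mul2_iso (assoc (one A) (one A) f) (iso_id g))) => /=.
rewrite mul2_whisk_l !compA pentagon (comp_reassoc (triangle _ _)) -assoc_nat_l.
by rewrite -triangle mul2_whisk_r (comp_reassoc (assoc_nat _ _ _)) !compA.
Qed.

Lemma runit_mul A B C (f : hom A B) (g : hom B C) :
  (idm f ⊙ runit g) ∘ assoc f g (one C) = runit (f ⋅ g).
Proof.
apply: mulr1_inj.
apply: (@iso_mono _ _ _ _ (assoc f g (one C))).
rewrite mul2_whisk_r -compA assoc_nat -triangle mul2_whisk_l !compA pentagon.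
by rewrite (comp_reassoc (eq_sym (assoc_nat_r _ _ _))) compA triangle.
Qed.

Lemma lunit_one A : fwd (lunit (one A)) = runit (one A).
Proof.
apply: mulr1_inj; rewrite -lunit_mul -triangle.
congr (_ ∘ _); apply: (@iso_mono _ _ _ _ (lunit (one A))).
by rewrite lunit_nat.
Qed.

(* The step of [star] in which γ is contracted against x.  It is locked because
   rewriting with [compA] would otherwise see through it. *)
Definition act A B C (p : hom A B) (q : hom B A) (γ : mor (p ⋅ q) (one A)) (x : hom A C) :
  mor (p ⋅ (q ⋅ x)) x :=
  locked (lunit x ∘ ((γ ⊙ idm x) ∘ inv (assoc p q x))).

Lemma actE A B C (p : hom A B) (q : hom B A) (γ : mor (p ⋅ q) (one A)) (x : hom A C) :
  act γ x = lunit x ∘ ((γ ⊙ idm x) ∘ inv (assoc p q x)).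
Proof. by rewrite /act -lock. Qed.

Lemma act_assoc A B C (p : hom A B) (q : hom B A) (γ : mor (p ⋅ q) (one A)) (x : hom A C) :
  act γ x ∘ assoc p q x = lunit x ∘ (γ ⊙ idm x).
Proof. by rewrite actE !compA fwdK compm1. Qed.

Lemma act_nat A B C (p : hom A B) (q : hom B A) (γ : mor (p ⋅ q) (one A)) (x y : hom A C)
    (α : mor x y) :
  act γ y ∘ (idm p ⊙ (idm q ⊙ α)) = α ∘ act γ x.
Proof.
apply: (@iso_epi _ _ _ _ (assoc p q x)).
rewrite !compA act_assoc -assoc_nat_r (comp_reassoc (act_assoc _ _)) compA -mul2_split.
by rewrite (comp_reassoc (eq_sym (lunit_nat α))) compA -mul2_split'.
Qed.

Lemma starE A B C (f : hom A B) (g : hom B A) (p : hom B C) (q : hom C B)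
    (η : mor (f ⋅ g) (one A)) (γ : mor (p ⋅ q) (one B)) :
  star η γ = η ∘ ((idm f ⊙ act γ g) ∘ assoc f p (q ⋅ g)).
Proof. by rewrite /star !actE !mul2_whisk_l !compA. Qed.

Lemma act_mul A B C D (p : hom A B) (q : hom B A) (γ : mor (p ⋅ q) (one A))
    (y : hom A C) (x : hom C D) :
  act γ (y ⋅ x) ∘ ((idm p ⊙ assoc q y x) ∘ assoc p (q ⋅ y) x) = act γ y ⊙ idm x.
Proof.
apply: (@iso_epi _ _ _ _ (mul2_iso (assoc p q y) (iso_id x))) => /=.
rewrite -mul2_whisk_r act_assoc !compA pentagon (comp_reassoc (act_assoc _ _)) mul2_whisk_r compA.
by rewrite -assoc_nat_l (comp_reassoc (lunit_mul _ _)).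
Qed.

Lemma act_star A B C D (f : hom A B) (g : hom B A) (p : hom B C) (q : hom C B)
    (η : mor (f ⋅ g) (one A)) (γ : mor (p ⋅ q) (one B)) (x : hom A D) :
  act (star η γ) x ∘ (idm (f ⋅ p) ⊙ inv (assoc q g x)) =
  act η x ∘ ((idm f ⊙ act γ (g ⋅ x)) ∘ assoc f p (q ⋅ (g ⋅ x))).
Proof.
apply: (@iso_epi _ _ _ _ (mul2_iso (iso_id (f ⋅ p)) (assoc q g x))) => /=.
rewrite !compA mul2M comp1m fwdK mul2_1 compm1 assoc_nat_r.
apply: (@iso_epi _ _ _ _ (assoc (f ⋅ p) (q ⋅ g) x)).
rewrite act_assoc !compA -pentagon.
rewrite (comp_reassoc (eq_sym (mul2_whisk_l _ _ _))).
rewrite (comp_reassoc (eq_sym (mul2_whisk_l _ _ _))) compA act_mul.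
rewrite (comp_reassoc (eq_sym (assoc_nat _ _ _))) compA (comp_reassoc (act_assoc _ _)).
by rewrite starE !mul2_whisk_r !compA.
Qed.

Lemma act_right A B (p : hom A B) (q : hom B A) (γ : mor (p ⋅ q) (one A))
    (ρ : mor (q ⋅ p) (one B)) :
  runit q ∘ (idm q ⊙ γ) ∘ assoc q p q = lunit q ∘ (ρ ⊙ idm q) ->
  act ρ q = runit q ∘ (idm q ⊙ γ).
Proof. by move=> e; apply: (@iso_epi _ _ _ _ (assoc q p q)); rewrite act_assoc e. Qed.

Lemma act_exchange A B C (p : hom A B) (q : hom B A) (γ : mor (p ⋅ q) (one A))
    (ρ : mor (q ⋅ p) (one B)) (x : hom A C) :
  runit q ∘ (idm q ⊙ γ) ∘ assoc q p q = lunit q ∘ (ρ ⊙ idm q) ->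
  idm q ⊙ act γ x = act ρ (q ⋅ x).
Proof.
move=> /act_right e.
apply: (@iso_epi _ _ _ _ (mul2_iso (iso_id q) (assoc p q x))) => /=.
apply: (@iso_epi _ _ _ _ (assoc q (p ⋅ q) x)).
rewrite -mul2_whisk_l act_assoc !compA act_mul e mul2_whisk_r -triangle mul2_whisk_l !compA.
by rewrite assoc_nat.
Qed.

Lemma star_right A B C (f : hom A B) (g : hom B A) (p : hom B C) (q : hom C B)
    (η : mor (f ⋅ g) (one A)) (ρ : mor (g ⋅ f) (one B))
    (γ : mor (p ⋅ q) (one B)) (μ : mor (q ⋅ p) (one C)) :
  runit g ∘ (idm g ⊙ η) ∘ assoc g f g = lunit g ∘ (ρ ⊙ idm g) ->
  runit q ∘ (idm q ⊙ γ) ∘ assoc q p q = lunit q ∘ (μ ⊙ idm q) ->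
  runit (q ⋅ g) ∘ (idm (q ⋅ g) ⊙ star η γ) ∘ assoc (q ⋅ g) (f ⋅ p) (q ⋅ g) =
  lunit (q ⋅ g) ∘ (star μ ρ ⊙ idm (q ⋅ g)).
Proof.
move=> e e'; rewrite -act_assoc; congr (_ ∘ _).
apply: (@iso_epi _ _ _ _ (mul2_iso (iso_id (q ⋅ g)) (iso_inv (assoc f p (q ⋅ g))))) => /=.
rewrite act_star -(act_exchange _ e') compA -mul2_whisk_l starE !compA invK compm1.
rewrite -runit_mul mul2_whisk_l !compA (comp_reassoc (assoc_nat_r _ _ _)) !compA assoc_nat_r.
rewrite !(comp_reassoc (eq_sym (mul2_whisk_l _ _ _))) -(act_right e).
by rewrite act_nat.
Qed.

Lemma star_assoc A B C D (f : hom A B) (g : hom B A) (p : hom B C) (q : hom C B)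
    (u : hom C D) (v : hom D C)
    (η : mor (f ⋅ g) (one A)) (γ : mor (p ⋅ q) (one B)) (θ : mor (u ⋅ v) (one C)) :
  star η (star γ θ) ∘ (assoc f p u ⊙ inv (assoc v q g)) = star (star η γ) θ.
Proof.
rewrite (starE η (star γ θ)) (starE (star η γ)) (starE η γ) !compA; congr (η ∘ _).
rewrite (mul2_split' (fwd (assoc f p u))) (comp_reassoc (assoc_nat_r _ _ _)) !compA.
rewrite (comp_reassoc (eq_sym (mul2_whisk_l _ _ _))) act_star !mul2_whisk_l !compA pentagon.
by rewrite (comp_reassoc (assoc_nat_r _ _ _)) !compA.
Qed.

Lemma star_runit A B (f : hom A B) (g : hom B A) (η : mor (f ⋅ g) (one A)) :
  η ∘ (runit f ⊙ lunit g) = star η (runit (one B)).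
Proof.
rewrite starE actE -triangle compA invK compm1; congr (η ∘ _).
by rewrite mul2_whisk_l compA -assoc_nat_r (comp_reassoc (triangle _ _)) -mul2_split.
Qed.

Lemma star_lunit A B (f : hom A B) (g : hom B A) (ρ : mor (g ⋅ f) (one B)) :
  ρ ∘ (lunit g ⊙ runit f) = star (lunit (one B)) ρ.
Proof.
rewrite starE !actE lunit_one (comp_reassoc (runit_nat ρ)) compA -runit_mul !compA invK compm1.
rewrite -lunit_one mul2_whisk_l !compA (comp_reassoc (lunit_nat ρ)) compA -assoc_nat_r.
by rewrite (comp_reassoc (lunit_mul _ _)) -mul2_split.
Qed.

End Coherence.

Lemma wide_oneP (𝓑 : bicategory) (A : 𝓑) : is_wide_context (wide_one_data A).
Proof.
split; rewrite /= lunit_one; last by rewrite -triangle lunit_one compA.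
by rewrite compA -triangle lunit_one.
Qed.

Definition wide_one (𝓑 : bicategory) (A : 𝓑) : wide_context A A := WideContext (wide_oneP A).

Lemma wide_mulP (𝓑 : bicategory) (A B C : 𝓑) (Γ : wide_context A B) (Λ : wide_context B C) :
  is_wide_context (wide_mul_data Γ Λ).
Proof.
have [e1 e2] := wP Γ; have [e3 e4] := wP Λ; split; first exact: star_right.
by symmetry; apply: star_right; symmetry.
Qed.

Definition wide_mul (𝓑 : bicategory) (A B C : 𝓑) (Γ : wide_context A B)
    (Λ : wide_context B C) : wide_context A C := WideContext (wide_mulP Γ Λ).

Lemma star_nat (𝓑 : bicategory) (A B C : 𝓑) (f f' : hom A B) (g g' : hom B A)
    (p p' : hom B C) (q q' : hom C B)
    (η : mor (f ⋅ g) (one A)) (η' : mor (f' ⋅ g') (one A))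
    (γ : mor (p ⋅ q) (one B)) (γ' : mor (p' ⋅ q') (one B))
    (α : mor f f') (β : mor g g') (ς : mor p p') (τ : mor q q') :
  η' ∘ (α ⊙ β) = η -> γ' ∘ (ς ⊙ τ) = γ ->
  star η' γ' ∘ ((α ⊙ ς) ⊙ (τ ⊙ β)) = star η γ.
Proof.
move=> <- <-; rewrite !starE !compA; congr (η' ∘ _).
rewrite assoc_nat (comp_reassoc (mul2M _ _ _ _)) (comp_reassoc (mul2M _ _ _ _)) comp1m compm1.
congr ((_ ⊙ _) ∘ _); apply: (@iso_epi _ _ _ _ (assoc p q g)).
rewrite !compA act_assoc -assoc_nat (comp_reassoc (act_assoc _ _)) compA mul2M comp1m.
by rewrite (comp_reassoc (eq_sym (lunit_nat β))) compA mul2M comp1m compm1.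
Qed.

Lemma wide_mul2P (𝓑 : bicategory) (A B C : 𝓑) (Γ Γ' : wide_context A B)
    (Λ Λ' : wide_context B C) (m : wide_mor Γ Γ') (n : wide_mor Λ Λ') :
  @is_wide_mor 𝓑 A C (wide_mul Γ Λ) (wide_mul Γ' Λ') (wα m ⊙ wα n) (wβ n ⊙ wβ m).
Proof. by have [m1 m2] := wmP m; have [n1 n2] := wmP n; split; exact: star_nat. Qed.

Definition wide_mult (𝓑 : bicategory) (A B C : 𝓑) :
  functor (prod_category (wide_category A B) (wide_category B C)) (wide_category A C).
Proof.
refine (@Functor (prod_category (wide_category A B) (wide_category B C)) (wide_category A C)
  (fun ΓΛ => wide_mul (fst ΓΛ) (snd ΓΛ))
  (fun _ _ mn => WideMor (wide_mul2P (fst mn) (snd mn))) _ _).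
- by move=> [Γ Λ]; apply: wide_mor_eq; rewrite /= mul2_1.
- by move=> x y z mn mn'; apply: wide_mor_eq; rewrite /= mul2M.
Defined.

Lemma wide_assocP (𝓑 : bicategory) (A B C D : 𝓑) (Γ : wide_context A B)
    (Λ : wide_context B C) (Ω : wide_context C D) :
  @is_wide_mor 𝓑 A D (wide_mul (wide_mul Γ Λ) Ω) (wide_mul Γ (wide_mul Λ Ω))
    (assoc (wf Γ) (wf Λ) (wf Ω)) (iso_inv (assoc (wg Ω) (wg Λ) (wg Γ))).
Proof.
split; rewrite /= /wide_mul_data /=; first exact: star_assoc.
by rewrite -star_assoc compA mul2M fwdK invK mul2_1 compm1.
Qed.

Lemma wide_runitP (𝓑 : bicategory) (A B : 𝓑) (Γ : wide_context A B) :
  @is_wide_mor 𝓑 A B (wide_mul Γ (wide_one B)) Γ (runit (wf Γ)) (lunit (wg Γ)).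
Proof. by split; [exact: star_runit | exact: star_lunit]. Qed.

Lemma wide_lunitP (𝓑 : bicategory) (A B : 𝓑) (Γ : wide_context A B) :
  @is_wide_mor 𝓑 A B (wide_mul (wide_one A) Γ) Γ (lunit (wf Γ)) (runit (wg Γ)).
Proof.
split; rewrite /= -?lunit_one.
- by rewrite star_lunit lunit_one.
- by rewrite star_runit lunit_one.
Qed.

Definition wide_bicat_data (𝓑 : bicategory) : bicat_data :=
  @BicatData 𝓑 (@wide_category 𝓑) (@wide_mult 𝓑) (@wide_one 𝓑)
    (fun A B C D Γ Λ Ω => @wide_iso 𝓑 A D (wide_mul (wide_mul Γ Λ) Ω)
       (wide_mul Γ (wide_mul Λ Ω)) _ _ (wide_assocP Γ Λ Ω))
    (fun A B Γ => @wide_iso 𝓑 A B (wide_mul Γ (wide_one B)) Γ _ _ (wide_runitP Γ))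
    (fun A B Γ => @wide_iso 𝓑 A B (wide_mul (wide_one A) Γ) Γ _ _ (wide_lunitP Γ)).

Lemma pentagon_inv (𝓑 : bicategory) (A B C D E : 𝓑) (f : hom A B) (g : hom B C)
    (h : hom C D) (k : hom D E) :
  (inv (assoc f g h) ⊙ idm k) ∘ inv (assoc f (g ⋅ h) k) ∘ (idm f ⊙ inv (assoc g h k)) =
  inv (assoc (f ⋅ g) h k) ∘ inv (assoc f g (h ⋅ k)).
Proof.
apply: (@iso_epi _ _ _ _ (mul2_iso (iso_id f) (assoc g h k))).
apply: (@iso_epi _ _ _ _ (assoc f (g ⋅ h) k)).
apply: (@iso_epi _ _ _ _ (mul2_iso (assoc f g h) (iso_id k))) => /=.
rewrite !compA (comp_reassoc (mul2M _ _ _ _)) fwdK comp1m mul2_1 comp1m pentagon.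
rewrite (comp_reassoc (fwdK (assoc f (g ⋅ h) k))) comp1m mul2M fwdK comp1m mul2_1.
by rewrite (comp_reassoc (fwdK (assoc f g (h ⋅ k)))) comp1m fwdK.
Qed.

Lemma wide_bicatP (𝓑 : bicategory) : is_bicategory (wide_bicat_data 𝓑).
Proof.
split.
- move=> A B C D f f' g g' h h' α β γ; apply: wide_mor_eq => /=; first exact: assoc_nat.
  apply: (@iso_epi _ _ _ _ (assoc (wg h) (wg g) (wg f))).
  apply: (@iso_mono _ _ _ _ (assoc (wg h') (wg g') (wg f'))).
  rewrite !compA fwdK compm1 (comp_reassoc (invK (assoc (wg h') (wg g') (wg f')))) comp1m.
  by rewrite assoc_nat.
- by move=> A B f f' α; apply: wide_mor_eq => /=; [exact: runit_nat | exact: lunit_nat].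
- by move=> A B f f' α; apply: wide_mor_eq => /=; [exact: lunit_nat | exact: runit_nat].
- move=> A B C D E f g h k; apply: wide_mor_eq => /=; first by rewrite compA pentagon.
  exact: pentagon_inv.
- move=> A B C f g; apply: wide_mor_eq => /=; first exact: triangle.
  by rewrite -triangle compA invK compm1.
Qed.

Definition wide_bicategory (𝓑 : bicategory) : bicategory := Bicategory (wide_bicatP 𝓑).

Definition image_data (𝓑 𝓑' : bicat_data) (F : hom_data 𝓑 𝓑') (A B : 𝓑)
    (Γ : wide_data A B) : wide_data (F A) (F B) :=
  @WideData 𝓑' (F A) (F B) (hfun F (wf Γ)) (hfun F (wg Γ))
    (inv (hΦ0 F A) ∘ fmor (hfun F) (wη Γ) ∘ hΦ1 F (wf Γ) (wg Γ))
    (inv (hΦ0 F B) ∘ fmor (hfun F) (wρ Γ) ∘ hΦ1 F (wg Γ) (wf Γ)).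

(* The prescribed values of W(F, Φ) are cells of W(B') only if the image of a context
   is a context ([HC]) and the images of 2-cells ([HM]) and the two families of
   constraints ([H1], [H0]) are 2-cells.  These facts are arguments here, to be
   established together with the coherence axioms. *)
Section WideHom.

Context (𝓑 𝓑' : bicategory) (F : hom_data 𝓑 𝓑').
Context (HC : forall (A B : 𝓑) (Γ : wide_context A B), is_wide_context (image_data F Γ)).
Context (HM : forall (A B : 𝓑) (Γ Γ' : wide_context A B) (m : wide_mor Γ Γ'),
  @is_wide_mor 𝓑' (F A) (F B) (image_data F Γ) (image_data F Γ')
    (fmor (hfun F) (wα m)) (fmor (hfun F) (wβ m))).
Context (H1 : forall (A B C : 𝓑) (Γ : wide_context A B) (Λ : wide_context B C),
  @is_wide_mor 𝓑' (F A) (F C)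
    (wide_mul_data (image_data F Γ) (image_data F Λ)) (image_data F (wide_mul Γ Λ))
    (hΦ1 F (wf Γ) (wf Λ)) (hΦ1 F (wg Λ) (wg Γ))).
Context (H0 : forall A : 𝓑,
  @is_wide_mor 𝓑' (F A) (F A) (wide_one_data (F A)) (image_data F (wide_one A))
    (hΦ0 F A) (hΦ0 F A)).

Definition image_context (A B : 𝓑) (Γ : wide_context A B) : wide_context (F A) (F B) :=
  WideContext (HC Γ).

Definition image_mor (A B : 𝓑) (Γ Γ' : wide_context A B) (m : wide_mor Γ Γ') :
    wide_mor (image_context Γ) (image_context Γ') :=
  WideMor (HM m).

Definition image_functor (A B : 𝓑) :
  functor (wide_category A B) (@wide_category 𝓑' (F A) (F B)).
Proof.
refine (@Functor (wide_category A B) (@wide_category 𝓑' (F A) (F B))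
  (@image_context A B) (@image_mor A B) _ _).
- by move=> Γ; apply: wide_mor_eq; rewrite /= fmor1.
- by move=> x y z n m; apply: wide_mor_eq; rewrite /= fmorM.
Defined.

Definition wide_hom_data : hom_data (wide_bicategory 𝓑) (wide_bicategory 𝓑') :=
  @HomData (wide_bicategory 𝓑) (wide_bicategory 𝓑') F image_functor
    (fun (A B C : 𝓑) Γ Λ => @wide_iso 𝓑' (F A) (F C)
       (wide_mul (image_context Γ) (image_context Λ)) (image_context (wide_mul Γ Λ))
       _ _ (H1 Γ Λ))
    (fun A : 𝓑 => @wide_iso 𝓑' (F A) (F A) (wide_one (F A)) (image_context (wide_one A))
       _ _ (H0 A)).

End WideHom.

(* Main.v *)
(* Contracting γ : pq -> I against a 1-cell x gives a 2-cell [act γ x] : p(qx) -> x,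
   and both the context axioms and the product of contexts are expressed through it.
   Up to the constraints Φ, a homomorphism carries [act γ x] to the contraction of the
   image of γ against F(x); hence it preserves contexts and their products.  The
   coherence axioms for W(F, Φ) then hold componentwise: the first component is that
   of F, the second is that of F with the order of composition reversed. *)
From Stdlib Require Import ssreflect.
Require Import Defs.

Set Implicit Arguments.
Unset Strict Implicit.
Unset Printing Implicit Defensive.

Local Open Scope bicat_scope.

Section ImageOfContexts.

Context (𝓑 𝓑' : bicategory) (F : homomorphism 𝓑 𝓑').
Implicit Types A B C D : 𝓑.

(** Taken for a single 2-cell, outside any context, so that the same lemmas serve both [η] and [ρ];
    by conversion it gives the two pairings of [image_data]. *)
Definition image_pairing A B (f : hom A B) (g : hom B A) (η : mor (f ⋅ g) (one A)) :
    mor (hfun F f ⋅ hfun F g) (one (F A)) :=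
  inv (hΦ0 F A) ∘ fmor (hfun F) η ∘ hΦ1 F f g.

Lemma hΦ1_nat_l A B C (f f' : hom A B) (g : hom B C) (α : mor f f') :
  hΦ1 F f' g ∘ (fmor (hfun F) α ⊙ idm (hfun F g)) =
  fmor (hfun F) (α ⊙ idm g) ∘ hΦ1 F f g.
Proof. by rewrite -fmor1 (hΦ1_nat (homP F)). Qed.

Lemma hΦ1_nat_r A B C (f : hom A B) (g g' : hom B C) (β : mor g g') :
  hΦ1 F f g' ∘ (idm (hfun F f) ⊙ fmor (hfun F) β) =
  fmor (hfun F) (idm f ⊙ β) ∘ hΦ1 F f g.
Proof. by rewrite -fmor1 (hΦ1_nat (homP F)). Qed.

Lemma fmor_assoc A B C D (f : hom A B) (g : hom B C) (h : hom C D) :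
  fmor (hfun F) (assoc f g h) ∘ (hΦ1 F (f ⋅ g) h ∘ (hΦ1 F f g ⊙ idm (hfun F h))) =
  hΦ1 F f (g ⋅ h) ∘ ((idm (hfun F f) ⊙ hΦ1 F g h)
    ∘ assoc (hfun F f) (hfun F g) (hfun F h)).
Proof. by rewrite -!compA (hΦ1_assoc (homP F)). Qed.

(** Here and in [fmor_lunit], the unit axiom is solved so that the inverse of Φ⁰ appears, as it does
    in [image_pairing]. *)
Lemma fmor_runit A B (f : hom A B) :
  fmor (hfun F) (runit f) ∘ hΦ1 F f (one B) =
  runit (hfun F f) ∘ (idm (hfun F f) ⊙ inv (hΦ0 F B)).
Proof.
apply: (@iso_epi _ _ _ _ (mul2_iso (iso_id (hfun F f)) (hΦ0 F B))) => /=.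
rewrite !compA -mul2_whisk_l fwdK mul2_1 compm1 (hΦ0_runit (homP F)) -compA -fmorM.
by rewrite invK fmor1 comp1m.
Qed.

Lemma fmor_lunit A B (f : hom A B) :
  fmor (hfun F) (lunit f) ∘ hΦ1 F (one A) f =
  lunit (hfun F f) ∘ (inv (hΦ0 F A) ⊙ idm (hfun F f)).
Proof.
apply: (@iso_epi _ _ _ _ (mul2_iso (hΦ0 F A) (iso_id (hfun F f)))) => /=.
rewrite !compA -mul2_whisk_r fwdK mul2_1 compm1 (hΦ0_lunit (homP F)) -compA -fmorM.
by rewrite invK fmor1 comp1m.
Qed.

(** After precomposition with the associator, the associativity axiom of [F] and naturality of Φ¹
    reduce this to the left unit constraint; there the inverse of Φ⁰, F(γ) and Φ¹ assemble into
    [image_pairing γ]. *)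
Lemma fmor_act A B C (p : hom A B) (q : hom B A) (γ : mor (p ⋅ q) (one A)) (x : hom A C) :
  fmor (hfun F) (act γ x) ∘ (hΦ1 F p (q ⋅ x) ∘ (idm (hfun F p) ⊙ hΦ1 F q x)) =
  act (image_pairing γ) (hfun F x).
Proof.
apply: (@iso_epi _ _ _ _ (assoc (hfun F p) (hfun F q) (hfun F x))).
rewrite act_assoc !compA -fmor_assoc -compA -fmorM act_assoc fmorM !compA.
rewrite (comp_reassoc (eq_sym (hΦ1_nat_l _ _))) compA (comp_reassoc (fmor_lunit _)) !compA.
by rewrite -!mul2_whisk_r -!compA.
Qed.

Lemma image_right A B (f : hom A B) (g : hom B A) (η : mor (f ⋅ g) (one A))
    (ρ : mor (g ⋅ f) (one B)) :
  runit g ∘ (idm g ⊙ η) ∘ assoc g f g = lunit g ∘ (ρ ⊙ idm g) ->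
  runit (hfun F g) ∘ (idm (hfun F g) ⊙ image_pairing η)
    ∘ assoc (hfun F g) (hfun F f) (hfun F g) =
  lunit (hfun F g) ∘ (image_pairing ρ ⊙ idm (hfun F g)).
Proof.
(* The context axiom becomes an equation for [act ρ g], to which [F] applies through [fmor_act]. *)
move=> /act_right e; rewrite -act_assoc -fmor_act e fmorM !compA.
rewrite (comp_reassoc (eq_sym (hΦ1_nat_r _ _))) compA (comp_reassoc (fmor_runit _)) !compA.
by rewrite /image_pairing !mul2_whisk_l !compA.
Qed.

Lemma image_star A B C (f : hom A B) (g : hom B A) (p : hom B C) (q : hom C B)
    (η : mor (f ⋅ g) (one A)) (γ : mor (p ⋅ q) (one B)) :
  image_pairing (star η γ) ∘ (hΦ1 F f p ⊙ hΦ1 F q g) =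
  star (image_pairing η) (image_pairing γ).
Proof.
rewrite !starE -fmor_act {1 2}/image_pairing !fmorM !compA (mul2_split (hΦ1 F f p)).
(* The factor Φ¹ at f, p enters the associativity axiom with third 1-cell qg; the factor at q, g
   slides through the associator to complete [fmor_act]. *)
rewrite -(compA (hΦ1 F _ (q ⋅ g))) (comp_reassoc (fmor_assoc _ _ _)) !compA assoc_nat_r.
rewrite !mul2_whisk_l.
by rewrite (comp_reassoc (eq_sym (hΦ1_nat_r _ _))) !compA.
Qed.

Lemma image_runit_one A :
  image_pairing (runit (one A)) ∘ (hΦ0 F A ⊙ hΦ0 F A) = runit (one (F A)).
Proof.
rewrite /image_pairing (compA (inv _)) fmor_runit !compA mul2M fwdK comp1m runit_nat.
by rewrite -compA fwdK comp1m.
Qed.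

Lemma image_contextP A B (Γ : wide_context A B) : is_wide_context (image_data F Γ).
Proof.
have [e e'] := wP Γ; split; first exact: image_right.
(* The other axiom is the same one with f, g and η, ρ interchanged. *)
by symmetry; apply: image_right.
Qed.

Lemma image_morP A B (Γ Γ' : wide_context A B) (m : wide_mor Γ Γ') :
  @is_wide_mor 𝓑' (F A) (F B) (image_data F Γ) (image_data F Γ')
    (fmor (hfun F) (wα m)) (fmor (hfun F) (wβ m)).
Proof.
have [e e'] := wmP m.
by split; rewrite /= -?e -?e' !fmorM !compA (hΦ1_nat (homP F)).
Qed.

Lemma image_mulP A B C (Γ : wide_context A B) (Λ : wide_context B C) :
  @is_wide_mor 𝓑' (F A) (F C)
    (wide_mul_data (image_data F Γ) (image_data F Λ)) (image_data F (wide_mul Γ Λ))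
    (hΦ1 F (wf Γ) (wf Λ)) (hΦ1 F (wg Λ) (wg Γ)).
Proof. by split; exact: image_star. Qed.

Lemma image_oneP A :
  @is_wide_mor 𝓑' (F A) (F A) (wide_one_data (F A)) (image_data F (wide_one A))
    (hΦ0 F A) (hΦ0 F A).
Proof. by split; rewrite /= ?lunit_one; exact: image_runit_one. Qed.

(** Second components multiply in reverse order, so the associativity constraint enters them through
    its inverse. *)
Lemma fmor_assoc_inv A B C D (f : hom A B) (g : hom B C) (h : hom C D) :
  fmor (hfun F) (inv (assoc f g h)) ∘ hΦ1 F f (g ⋅ h) ∘ (idm (hfun F f) ⊙ hΦ1 F g h) =
  hΦ1 F (f ⋅ g) h ∘ (hΦ1 F f g ⊙ idm (hfun F h))
    ∘ inv (assoc (hfun F f) (hfun F g) (hfun F h)).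
Proof.
apply: iso_moveL.
by rewrite !compA -fmor_assoc -compA -fmorM fwdK fmor1 comp1m.
Qed.

Lemma wide_homP :
  is_homomorphism (wide_hom_data image_contextP image_morP image_mulP image_oneP).
Proof.
split.
- by move=> *; apply: wide_mor_eq; exact: (hΦ1_nat (homP F)).
- move=> *; apply: wide_mor_eq; first exact: (hΦ1_assoc (homP F)).
  exact: fmor_assoc_inv.
(* In second components the left and right unit constraints change places. *)
- move=> *; apply: wide_mor_eq; first exact: (hΦ0_runit (homP F)).
  exact: (hΦ0_lunit (homP F)).
- move=> *; apply: wide_mor_eq; first exact: (hΦ0_lunit (homP F)).
  exact: (hΦ0_runit (homP F)).
Qed.

End ImageOfContexts.

(** The quantified proofs only certify that the prescribed values are cells; the final equation
    fixes all the data of [H]. *)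
Theorem proposition1p10 (𝓑 𝓑' : bicategory) (F : homomorphism 𝓑 𝓑') :
  exists (H : homomorphism (wide_bicategory 𝓑) (wide_bicategory 𝓑'))
    (HC : forall (A B : 𝓑) (Γ : wide_context A B), is_wide_context (image_data F Γ))
    (HM : forall (A B : 𝓑) (Γ Γ' : wide_context A B) (m : wide_mor Γ Γ'),
      @is_wide_mor 𝓑' (F A) (F B) (image_data F Γ) (image_data F Γ')
        (fmor (hfun F) (wα m)) (fmor (hfun F) (wβ m)))
    (H1 : forall (A B C : 𝓑) (Γ : wide_context A B) (Λ : wide_context B C),
      @is_wide_mor 𝓑' (F A) (F C)
        (wide_mul_data (image_data F Γ) (image_data F Λ)) (image_data F (wide_mul Γ Λ))
        (hΦ1 F (wf Γ) (wf Λ)) (hΦ1 F (wg Λ) (wg Γ)))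
    (H0 : forall A : 𝓑,
      @is_wide_mor 𝓑' (F A) (F A) (wide_one_data (F A)) (image_data F (wide_one A))
        (hΦ0 F A) (hΦ0 F A)),
    homdata H = wide_hom_data HC HM H1 H0.
Proof.
exists (Homomorphism (wide_homP F)).
by exists (image_contextP F), (image_morP F), (image_mulP F), (image_oneP F).
Qed.
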